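(* Let $\Omega\subset\mathbb{R}^2$ be a bounded open set, let $a_0>0$ be a constant, and let $\phi$ be a smooth, monotone increasing real-valued function with $\phi(f)$ bounded, so that $k:=1+a_0\phi(f)$ is bounded and strictly positive. Consider the system for $\mathbf{u}=(u,v)$ $$\begin{cases}\dfrac{\partial u}{\partial t}=\Delta u+a_0\dfrac{\partial}{\partial x}[\phi(f)(u_x+v_y)]&\text{in }\Omega\times(0,\infty),\\[0.2cm] \dfrac{\partial v}{\partial t}=\Delta v+a_0\dfrac{\partial}{\partial y}[\phi(f)(u_x+v_y)]&\text{in }\Omega\times(0,\infty),\\ u(x,y,0)=u_0,\quad v(x,y,0)=v_0&\text{in }\Omega,\\ u=0,\quad v=0&\text{on }\partial\Omega\times(0,\infty),\end{cases}$$ and write its evolution equations as $\dfrac{\partial\mathbf{u}}{\partial t}=A\mathbf{u}$ with $$A\mathbf{u}=\begin{bmatrix}\Delta u+a_0\,\partial_x[\phi(f)(u_x+v_y)]\\ \Delta v+a_0\,\partial_y[\phi(f)(u_x+v_y)]\end{bmatrix}.$$ Let $$R=\begin{bmatrix}\partial_y&-\partial_x\\ \partial_x&\partial_y\end{bmatrix},\qquad D=\begin{bmatrix}\Delta&0\\0&\Delta\circ k\end{bmatrix}.$$ Then applying $R$ to the system gives $RA\mathbf{u}=DR\mathbf{u}$ and hence $$\frac{\partial}{\partial t}(R\mathbf{u})=DR\mathbf{u},$$ so that $D=RAR^{-1}$, i.e. the operator $A$ is diagonalized by the Cauchy-Riemann operator matrix $R$. The decoupled system takes the form $$\frac{\partial\xi}{\partial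 t}=\Delta\xi,\qquad \frac{\partial\zeta}{\partial t}=\Delta(k\zeta),$$ where $\xi:=u_y-v_x$ is the curl and $\zeta:=u_x+v_y$ is the divergence of the flow.
   Context: Here $f$ is an image on $\Omega$, $\phi(f)$ is an image-dependent weight, $\mathbf{u}=(u,v)$ is a flow field depending on $(x,y)\in\Omega$ and on the evolution time $t$, $(u_0,v_0)$ is an initial flow estimate, and $a_0=\beta/\alpha$ is the ratio of two positive weight parameters. The setting is that of Sobolev spaces: derivatives are taken in the distributional sense, so their order can be interchanged. The symbol $k$ denotes both the function $1+a_0\phi(f)$ and the operator of multiplication by it, so $\Delta\circ k$ is the operator $w\mapsto\Delta(kw)$. $R$ is called the Cauchy-Riemann operator matrix and $R^{-1}$ denotes its inverse. *)

(* Defs.v *)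
From HB Require Import structures.
From mathcomp Require Import all_boot all_order all_algebra.
From mathcomp Require Import all_classical all_reals all_analysis.
From mathcomp Require Import measurable_realfun.
Set Implicit Arguments.
Unset Strict Implicit.
Unset Printing Implicit Defensive.
Import Order.TTheory GRing.Theory Num.Theory.
Import numFieldNormedType.Exports.
Local Open Scope classical_set_scope.
Local Open Scope ring_scope.

Section TestFunctions.
Context {R : realType} {V : normedModType R}.
Implicit Types (psi : V -> R) (U K : set V) (vs : seq V) (v p : V).

Definition iterD vs psi : V -> R := foldr (fun v g => 'D_v g) psi vs.

Definition smooth psi : Prop := forall vs,
  continuous (iterD vs psi) /\ forall v p, derivable (iterD vs psi) p v.

Definition supp psi : set V := closure [set p | psi p != 0].

Definition is_test U psi : Prop :=
  [/\ smooth psi, compact (supp psi) & supp psi `<=` U].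

Definition test_pred U : {pred (V -> R)} := fun psi => `[< is_test U psi >].

Lemma supp_out psi p : ~ supp psi p -> \forall q \near p, psi q = 0.
Proof.
move=> np; have : nbhs p (~` supp psi).
  by apply: open_nbhs_nbhs; split => //; exact/closed_openC/closed_closure.
apply: filterS => q nq; apply: contrapT => /eqP q0; apply: nq.
exact: subset_closure.
Qed.

Lemma suppS psi K : closed K -> (forall p, ~ K p -> psi p = 0) ->
  supp psi `<=` K.
Proof.
move=> cK h; rewrite (closure_id K).1 //.
apply: closureS => p /= p0; apply: contrapT => /h /eqP.
by rewrite (negbTE p0).
Qed.

Lemma supp_eq0 psi p : ~ supp psi p -> psi p = 0.
Proof. by move=> /supp_out /nbhs_singleton. Qed.

Lemma supp_derive v psi : supp ('D_v psi) `<=` supp psi.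
Proof.
apply: suppS => [|p /supp_out p0]; first exact: closed_closure.
by rewrite (@near_eq_derive _ _ _ psi (cst 0) p v) ?derive_cst.
Qed.

Lemma iterD0 vs : iterD vs (0 : V -> R) = 0.
Proof. by elim: vs => //= v vs ->; apply/funext => p; exact: derive_cst. Qed.

Lemma iterDP vs a psi1 psi2 : smooth psi1 -> smooth psi2 ->
  iterD vs (a *: psi1 + psi2) = a *: iterD vs psi1 + iterD vs psi2.
Proof.
move=> s1 s2; elim: vs => //= v vs ->; apply/funext => p.
have d1 : derivable (iterD vs psi1) p v := (s1 vs).2 v p.
have d2 : derivable (iterD vs psi2) p v := (s2 vs).2 v p.
by rewrite deriveD ?deriveZ //; exact: derivableZ.
Qed.

Lemma smooth_derive v psi : smooth psi -> smooth ('D_v psi).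
Proof.
move=> s vs; have -> : iterD vs ('D_v psi) = iterD (rcons vs v) psi.
  by rewrite /iterD foldr_rcons.
exact: s.
Qed.

Lemma test_submod_closed U : submod_closed (test_pred U).
Proof.
split.
  apply/asboolP; have s0 : supp (0 : V -> R) = set0.
    apply/seteqP; split => // p.
    by apply: (@suppS 0 set0) => //; exact: closed0.
  split; rewrite ?s0//; last exact: compact0.
  move=> vs; rewrite iterD0; split => [|v p]; first exact: cst_continuous.
  exact: derivable_cst.
move=> a psi1 psi2 /asboolP[s1 c1 U1] /asboolP[s2 c2 U2]; apply/asboolP.
have sU : supp (a *: psi1 + psi2) `<=` supp psi1 `|` supp psi2.
  apply: suppS => [|p /not_orP[/supp_eq0 p1 /supp_eq0 p2]].
    by apply: closedU; exact: closed_closure.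
  by rewrite (_ : _ p = a * psi1 p + psi2 p)// p1 p2 mulr0 addr0.
split.
- move=> vs; rewrite iterDP//; split => [p|v p].
    by apply: cvgD; [apply: cvgZr; exact: (s1 vs).1|exact: (s2 vs).1].
  by apply: derivableD; [apply: derivableZ; exact: (s1 vs).2|exact: (s2 vs).2].
- apply: (subclosed_compact _ _ sU); first exact: closed_closure.
  exact: compactU.
- by move=> p /sU[/U1|/U2].
Qed.

HB.instance Definition _ U :=
  GRing.isSubmodClosed.Build R (V -> R) (test_pred U) (test_submod_closed U).

Record testfun U := Testfun {
  testfun_val :> V -> R;
  testfun_valP : testfun_val \in test_pred U }.

HB.instance Definition _ U := [isSub for @testfun_val U].
HB.instance Definition _ U := [Choice of testfun U by <:].
HB.instance Definition _ U := [SubChoice_isSubLmodule of testfun U by <:].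

Lemma testfunP U (psi : testfun U) : is_test U psi.
Proof. by have /asboolP := testfun_valP psi. Qed.

Lemma testfun_derive_subproof U v (psi : testfun U) : 'D_v psi \in test_pred U.
Proof.
have [s c sU] := testfunP psi; apply/asboolP; split.
- exact: smooth_derive.
- by apply: (subclosed_compact _ c (@supp_derive _ _)); exact: closed_closure.
- exact: subset_trans (@supp_derive _ _) sU.
Qed.

Definition testfun_derive U v (psi : testfun U) : testfun U :=
  Testfun (testfun_derive_subproof v psi).

Definition test_cvg0 U (psi : nat -> testfun U) : Prop :=
  (exists K, [/\ compact K, K `<=` U & forall n, supp (psi n) `<=` K]) /\
  forall vs (e : R), 0 < e ->
    \forall n \near \oo, forall p, `|iterD vs (psi n) p| < e.

Definition is_dist U (T : testfun U -> R) : Prop :=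
  linear T /\ forall psi : nat -> testfun U,
    test_cvg0 psi -> T (psi n) @[n --> \oo] --> 0.

Definition dist_pred U : {pred (testfun U -> R)} := fun T => `[< is_dist T >].

Lemma dist_submod_closed U : submod_closed (@dist_pred U).
Proof.
split.
  apply/asboolP; split => [a f g|psi _]; last exact: cvg_cst.
  by rewrite scaler0 addr0.
move=> a S T /asboolP[lS cS] /asboolP[lT cT]; apply/asboolP; split.
  move=> b f g; have E h : (a *: S + T) h = a * S h + T h by [].
  rewrite !E lS lT (_ : _ *: _ = b * S f)// (_ : _ *: _ = b * T f)//.
  by rewrite (_ : _ *: _ = b * (a * S f + T f))// !mulrDr !mulrA (mulrC a b) addrACA.
move=> psi psi0; have -> : (0 : R) = a *: 0 + 0 by rewrite scaler0 addr0.
by apply: cvgD; [apply: cvgZr; exact: cS|exact: cT].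
Qed.

HB.instance Definition _ U := GRing.isSubmodClosed.Build R (testfun U -> R)
  (@dist_pred U) (@dist_submod_closed U).

(* The topology of the space of test functions is an inductive limit of Frechet
   topologies, so sequential continuity is continuity for linear functionals *)
Record dist U := Dist {
  dist_val :> testfun U -> R;
  dist_valP : dist_val \in @dist_pred U }.

HB.instance Definition _ U := [isSub for @dist_val U].
HB.instance Definition _ U := [Choice of dist U by <:].
HB.instance Definition _ U := [SubChoice_isSubLmodule of dist U by <:].

Lemma distP U (T : dist U) : is_dist T.
Proof. by have /asboolP := dist_valP T. Qed.

Lemma dist_derive_subproof U v (T : dist U) :
  (fun psi : testfun U => - T (testfun_derive v psi)) \in @dist_pred U.
Proof.
have [lT cT] := distP T; apply/asboolP; split.
  move=> a f g; have -> : testfun_derive v (a *: f + g) =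
      a *: testfun_derive v f + testfun_derive v g.
    apply: val_inj; have [sf _ _] := testfunP f; have [sg _ _] := testfunP g.
    exact: (iterDP [:: v]).
  by rewrite lT opprD -scalerN.
move=> psi [[K [cK KU sK]] psi0]; rewrite -oppr0; apply: cvgN; apply: cT.
split; first by exists K; split => // n; apply: subset_trans (sK n);
  exact: supp_derive.
move=> vs e e0; have := psi0 (rcons vs v) e e0.
apply: filterS => n h p /=.
by have := h p; rewrite /iterD foldr_rcons.
Qed.

Definition dist_derive U v (T : dist U) : dist U :=
  Dist (dist_derive_subproof v T).

End TestFunctions.

Section Plane.
Context {R : realType}.
Local Notation mu2 := (@lebesgue_measure R \x @lebesgue_measure R)%E.
Local Notation RR := (measurableTypeR R * measurableTypeR R)%type.
Implicit Types (Omega K : set (R * R)) (g m : R * R -> R).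

Lemma open_measurable2 Omega : open Omega -> measurable Omega.
Proof.
move=> oO.
pose box (q : (rat * rat) * (rat * rat)) : set (R * R) :=
  `]ratr q.1.1, ratr q.1.2[%classic `*` `]ratr q.2.1, ratr q.2.2[%classic.
have -> : Omega =
    \bigcup_q (if `[< box q `<=` Omega >] then box q else set0).
  apply/seteqP; split => [[x y] Oxy|p [q _]]; last first.
    by case: asboolP => // h; exact: h.
  have /nbhs_ballP[e /= e0 be] : nbhs (x, y) Omega by exact: open_nbhs_nbhs.
  have lt1 (z : R) : z - e < z by rewrite ltrBlDr ltrDl.
  have lt2 (z : R) : z < z + e by rewrite ltrDl.
  have [a] := rat_in_itvoo (lt1 x); rewrite in_itv/= => /andP[xa ax].
  have [b] := rat_in_itvoo (lt2 x); rewrite in_itv/= => /andP[xb bx].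
  have [c] := rat_in_itvoo (lt1 y); rewrite in_itv/= => /andP[yc cy].
  have [d] := rat_in_itvoo (lt2 y); rewrite in_itv/= => /andP[yd dy].
  exists ((a, b), (c, d)) => //; case: asboolP => [_|[]].
    by split; rewrite /= in_itv/= ?ax ?cy.
  move=> [z w] [/=]; rewrite !in_itv/= => /andP[az zb] /andP[cw wd].
  apply: be; split; rewrite /= ball_itv /= in_itv /=.
    by rewrite (lt_trans xa)//= (lt_trans zb).
  by rewrite (lt_trans yc)//= (lt_trans wd).
apply: countable_bigcupT_measurable => [|q]; first exact: countableP.
by case: asboolP => // _; exact: measurableX.
Qed.

Lemma continuous_measurable_fun2 Omega g : measurable Omega -> continuous g ->
  measurable_fun Omega g.
Proof.
move=> mO cg; apply: (measurability _ (RGenOpens.measurableE R)).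
move=> _ [_ [a [b ->] <-]]; apply: measurableI => //.
apply: open_measurable2.
by apply: open_comp => [p _|]; [exact: cg|exact: interval_open].
Qed.

Definition loc_integrable Omega g : Prop :=
  [/\ measurable_fun Omega g, open Omega &
    forall K, K `<=` Omega -> compact K ->
      (\int[mu2]_(p in K) `|g p|%:E < +oo)%E].

Lemma compact_measurable2 K : compact K -> measurable K.
Proof.
move=> cK; have clK : closed K.
  by apply: compact_closed => //; exact: (@norm_hausdorff R (R * R)%type).
rewrite -[K]setCK; apply: measurableC; apply: open_measurable2.
exact: closed_openC.
Qed.

Lemma loc_integrable_restrict Omega g K : loc_integrable Omega g ->
  compact K -> K `<=` Omega -> mu2.-integrable Omega (EFin \o (g \_ K)).
Proof.
move=> [mg oO ig] cK KO.
have mO : measurable (Omega : set RR) := open_measurable2 oO; have mK : measurable (K : set RR) := compact_measurable2 cK.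
rewrite -restrict_EFin; apply/(integrable_mkcond _ mO).
have -> : ((EFin \o g) \_ K) \_ Omega = (EFin \o g) \_ K.
  apply/funext => p; rewrite !patchE; case: ifPn => // pO.
  by case: ifPn => //; rewrite inE => /KO/mem_set; rewrite (negbTE pO).
apply/(integrable_mkcond _ mK)/integrableP; split.
  by apply/measurable_EFinP; apply: (measurable_funS mO KO).
exact: ig.
Qed.

Lemma loc_integrable_mul Omega g K (psi : R * R -> R) (M : R) :
  loc_integrable Omega g -> compact K -> K `<=` Omega -> continuous psi ->
  (forall p, ~ K p -> psi p = 0) -> (forall p, `|psi p| <= M) ->
  mu2.-integrable Omega (EFin \o (g \* psi)) /\
  `|\int[mu2]_(p in Omega) (g p * psi p)| <=
    M * \int[mu2]_(p in Omega) `|(g \_ K) p|.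
Proof.
move=> lg cK KO cpsi psi0 psiM; have [mg oO ig] := lg.
have mO : measurable (Omega : set RR) := open_measurable2 oO.
have igK := loc_integrable_restrict lg cK KO.
have igKa : mu2.-integrable Omega (EFin \o (fun p => `|(g \_ K) p|)).
  exact: integrable_abse igK.
have le p : `|g p * psi p| <= M * `|(g \_ K) p|.
  rewrite normrM mulrC patchE; case: ifPn => [_|].
    by rewrite ler_wpM2r.
  by rewrite notin_setE => /psi0 ->; rewrite !normr0 mul0r mulr0.
have iM : mu2.-integrable Omega (EFin \o (fun p => M * `|(g \_ K) p|)).
  exact: (integrableZl mO M igKa).
have i : mu2.-integrable Omega (EFin \o (g \* psi)).
  apply: (le_integrable mO _ _ iM).
    apply/measurable_EFinP/measurable_funM => //.
    exact: continuous_measurable_fun2.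
  move=> p _; rewrite /= lee_fin (le_trans (le p))// ler_norm//.
split => //.
rewrite -RintegralZl//; apply: (le_trans (le_normr_Rintegral mO i)).
apply: le_Rintegral => // [|p _]; first exact: (integrable_abse i).
exact: le.
Qed.

Definition fun_dist_val Omega g (psi : testfun Omega) : R :=
  if `[< loc_integrable Omega g >]
  then \int[mu2]_(p in Omega) (g p * psi p) else 0.

Lemma test_bounded Omega (psi : testfun Omega) :
  exists M, forall p, `|psi p| <= M.
Proof.
have [s c _] := testfunP psi; have cpsi : continuous psi := (s [::]).1.
have : compact (psi @` supp psi).
  by apply: continuous_compact => //; exact: continuous_subspaceT.
move=> /compact_bounded [M [_ /(_ (M + 1))]]; rewrite ltrDl => /(_ ltr01) h.
exists (Num.max 0 (M + 1)) => p; rewrite le_max.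
have [/supp_eq0 ->|np] := pselect (~ supp psi p); first by rewrite normr0 lexx.
by rewrite h ?orbT//; exists p => //; exact: contrapT.
Qed.

Lemma loc_integrable_test Omega g (psi : testfun Omega) :
  loc_integrable Omega g -> mu2.-integrable Omega (EFin \o (g \* psi)).
Proof.
move=> lg; have [s c sO] := testfunP psi; have [M psiM] := test_bounded psi.
have psi0 p : ~ supp psi p -> psi p = 0 by exact: supp_eq0.
by have [] := loc_integrable_mul lg c sO (s [::]).1 psi0 psiM.
Qed.

Lemma fun_dist_subproof Omega g : fun_dist_val g \in @dist_pred _ _ Omega.
Proof.
apply/asboolP; rewrite /fun_dist_val; case: asboolP => lg; last first.
  split => [a f h|psi _]; last exact: cvg_cst.
  by rewrite scaler0 addr0.
have [mg oO _] := lg; have mO : measurable (Omega : set RR) := open_measurable2 oO.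
split => [a f h|psi [[K [cK KO sK]] psi0]].
  have i1 := loc_integrable_test f lg; have i2 := loc_integrable_test h lg.
  rewrite (_ : _ *: _ = a * \int[mu2]_(p in Omega) (g p * f p))//.
  rewrite -RintegralZl// -RintegralD//; last exact: (integrableZl mO a i1).
  apply: eq_Rintegral => p _.
  have -> : (a *: f + h : testfun Omega) p = a * f p + h p by [].
  by rewrite mulrDr mulrCA.
pose C := \int[mu2]_(p in Omega) `|(g \_ K) p|.
have C0 : 0 <= C by exact: Rintegral_ge0.
apply/cvgrPdist_lt => e e0; have d0 : 0 < e / (C + 1).
  by rewrite divr_gt0// ltr_wpDl.
have := psi0 [::] _ d0; apply: filterS => n h /=.
rewrite sub0r normrN; have [s _ _] := testfunP (psi n).
have hM p : `|psi n p| <= e / (C + 1) by exact: (ltW (h p)).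
have z p : ~ K p -> psi n p = 0.
  by move=> nK; apply: supp_eq0 => /sK.
have [_ /le_lt_trans->//] := loc_integrable_mul lg cK KO (s [::]).1 z hM.
by rewrite -/C mulrAC ltr_pdivrMr ?ltr_wpDl// ltr_pM2l// ltrDl.
Qed.

Definition fun_dist Omega g : dist Omega := Dist (fun_dist_subproof Omega g).

Lemma fun_distE Omega g (psi : testfun Omega) : loc_integrable Omega g ->
  fun_dist Omega g psi = \int[mu2]_(p in Omega) (g p * psi p).
Proof. by move=> lg; rewrite /fun_dist /= /fun_dist_val asboolT. Qed.

(* The function of which T is the associated distribution; it is unique up to a
   null set when it exists, so that [mult] below depends on T only. *)
Definition density Omega (T : dist Omega) : R * R -> R :=
  xget (cst 0) [set g | loc_integrable Omega g /\ T = fun_dist Omega g].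

Definition regular Omega (T : dist Omega) : Prop :=
  exists2 g, loc_integrable Omega g & T = fun_dist Omega g.

Definition mult Omega m (T : dist Omega) : dist Omega :=
  fun_dist Omega (m \* density T).

Section Operators.
Context {Omega : set (R * R)}.
Implicit Types (T u v : dist Omega) (U : dist Omega * dist Omega).

Definition dx T : dist Omega := dist_derive ((1, 0) : R * R) T.
Definition dy T : dist Omega := dist_derive ((0, 1) : R * R) T.
Definition laplacian T : dist Omega := dx (dx T) + dy (dy T).

Definition curl U : dist Omega := dy U.1 - dx U.2.
Definition divergence U : dist Omega := dx U.1 + dy U.2.

Definition operator_matrix (a b c d : dist Omega -> dist Omega) U :
    dist Omega * dist Omega :=
  (a U.1 + b U.2, c U.1 + d U.2).

Definition cauchy_riemann : dist Omega * dist Omega -> dist Omega * dist Omega :=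
  operator_matrix dy (fun T => - dx T) dx dy.

Definition diagonal_op (k : R * R -> R) :
    dist Omega * dist Omega -> dist Omega * dist Omega :=
  operator_matrix laplacian (fun=> 0) (fun=> 0) (laplacian \o mult k).

(* w stands for phi(f) *)
Definition flow_op (a0 : R) (w : R * R -> R) U : dist Omega * dist Omega :=
  (laplacian U.1 + a0 *: dx (mult w (dx U.1 + dy U.2)),
   laplacian U.2 + a0 *: dy (mult w (dx U.1 + dy U.2))).

(* dw/dt = w' as distributions in t with values in the distributions on Omega:
   for every test function psi on Omega, the function t |-> <w(t), psi> has
   weak derivative t |-> <w'(t), psi> on ]0, +oo[ *)
Definition time_derivative (w w' : R -> dist Omega) : Prop :=
  forall psi : testfun Omega,
    [/\ locally_integrable `]0, +oo[ (fun t => w t psi),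
        locally_integrable `]0, +oo[ (fun t => w' t psi) &
        forall eta : testfun (`]0, +oo[%classic : set R),
          \int[lebesgue_measure]_(t in `]0, +oo[) (w t psi * 'D_1 eta t) =
          - \int[lebesgue_measure]_(t in `]0, +oo[) (w' t psi * eta t)].

Definition time_derivative2 (w w' : R -> dist Omega * dist Omega) : Prop :=
  time_derivative (fun t => (w t).1) (fun t => (w' t).1) /\
  time_derivative (fun t => (w t).2) (fun t => (w' t).2).

End Operators.

Definition square_integrable Omega g : Prop :=
  measurable_fun Omega g /\ (\int[mu2]_(p in Omega) (g p ^+ 2)%:E < +oo)%E.

Definition L2_cvg Omega (h : nat -> R * R -> R) g : Prop :=
  (\int[mu2]_(p in Omega) ((h n p - g p) ^+ 2)%:E)%E @[n --> \oo] --> 0%E.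

(* the Sobolev space H^1_0(Omega): the closure of the test functions in the
   space of those T in L^2 whose derivatives dx T and dy T are in L^2 *)
Definition H10 Omega : set (dist Omega) := [set T | exists g gx gy,
  [/\ [/\ square_integrable Omega g, square_integrable Omega gx &
          square_integrable Omega gy],
      [/\ T = fun_dist Omega g, dx T = fun_dist Omega gx &
          dy T = fun_dist Omega gy] &
      exists psi : nat -> testfun Omega,
        [/\ L2_cvg Omega psi g,
            L2_cvg Omega (fun n => 'D_(1, 0) (psi n)) gx &
            L2_cvg Omega (fun n => 'D_(0, 1) (psi n)) gy]]].

(* the initial-boundary value problem; u = v = 0 on the boundary means that
   u(t) and v(t) are in H^1_0(Omega) *)
Definition flow_system Omega (a0 : R) (w : R * R -> R) (u0 v0 : dist Omega)
    (u v : R -> dist Omega) : Prop :=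
  [/\ time_derivative u (fun t =>
        laplacian (u t) + a0 *: dx (mult w (dx (u t) + dy (v t)))),
      time_derivative v (fun t =>
        laplacian (v t) + a0 *: dy (mult w (dx (u t) + dy (v t)))),
      (forall psi, u t psi @[t --> 0^'+] --> u0 psi) /\
      (forall psi, v t psi @[t --> 0^'+] --> v0 psi) &
      forall t, 0 < t -> H10 (u t) /\ H10 (v t)].

End Plane.

(* Main.v *)
Require Import Defs.
From HB Require Import structures.
From mathcomp Require Import all_boot all_order all_algebra.
From mathcomp Require Import all_classical all_reals all_analysis.
From mathcomp Require Import measurable_realfun ring lra.
Set Implicit Arguments.
Unset Strict Implicit.
Unset Printing Implicit Defensive.
Import Order.TTheory GRing.Theory Num.Theory.
Import numFieldNormedType.Exports.
Local Open Scope classical_set_scope.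
Local Open Scope ring_scope.

(* Distributional derivatives commute, by Schwarz's theorem for test functions,
   so the two terms a0 dx (phi div) and a0 dy (phi div) cancel in the curl and
   add up to a0 Delta (phi div) in the divergence; since k = 1 + a0 phi this is
   R A = D R.  If u, v are in H^1_0 and the curl and the divergence of (u, v)
   vanish, then u and v are harmonic.  Testing Delta u = 0 against test
   functions psi_n -> u in H^1 gives D psi_n -> 0 in L^2, and the Poincare
   inequality gives psi_n -> 0, hence u = 0.  So R is injective on the domain
   of A. *)

(** * Symmetry of mixed derivatives, for test functions and for distributions *)

Section Schwarz.
Context {R : realType} {V : normedModType R}.
Implicit Types (psi : V -> R) (p q u v : V).

Lemma is_derive_line psi p v (s : R) : derivable psi (p + s *: v) v ->
  is_derive s 1 (fun t => psi (p + t *: v)) ('D_v psi (p + s *: v)).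
Proof.
(* The difference quotient of the restriction to the line is the directional quotient of [psi] at
   [p + s *: v], up to reassociating the sum. *)
have E : (fun h : R => h^-1 *: (((fun t => psi (p + t *: v)) \o shift s) (h *: 1)
      - psi (p + s *: v))) =
    (fun h => h^-1 *: ((psi \o shift (p + s *: v)) (h *: v) - psi (p + s *: v))).
  apply/funext => h /=; congr (_ *: (psi _ - _)).
  by rewrite [h *: 1]mulr1 scalerDl addrCA.
by move=> d; apply: DeriveDef; rewrite /derivable /derive E.
Qed.

Lemma mvt_line psi p v (h : R) : 0 < h -> (forall q, derivable psi q v) ->
  exists2 s, 0 < s < h & psi (p + h *: v) - psi p = 'D_v psi (p + s *: v) * h.
Proof.
move=> h0 d; pose g t := psi (p + t *: v).
have dg (x : R) : is_derive x 1 g ('D_v psi (p + x *: v)) by exact: is_derive_line.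
have [|s] := @MVT _ g (fun x => 'D_v psi (p + x *: v)) _ _ h0 (fun x _ => dg x).
  apply: continuous_subspaceT => x; apply: differentiable_continuous.
  by apply/derivable1_diffP; have [] := dg x.
by rewrite in_itv /= /g scale0r addr0 subr0; exists s.
Qed.

Lemma smooth_derivable psi v p : smooth psi -> derivable psi p v.
Proof. by move=> /(_ [::])[_]; exact. Qed.

Lemma smooth_continuous psi : smooth psi -> continuous psi.
Proof. by move=> /(_ [::])[]. Qed.

(* Both mixed derivatives take, at points close to p, the value of the second
   difference of psi along u and v. *)
Lemma second_difference psi p u v (h : R) : smooth psi -> 0 < h ->
  exists s t : R, [/\ 0 < s < h, 0 < t < h &
    psi (p + h *: u + h *: v) - psi (p + h *: u) - (psi (p + h *: v) - psi p) =
    'D_v ('D_u psi) (p + s *: u + t *: v) * h * h].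
Proof.
move=> sp h0.
(* The second difference is the increment of [g] along [u]. The mean value theorem applies first to
   [g] along [u], then to ['D_u psi] along [v]. *)
pose g q := psi (q + h *: v) - psi q.
have E q : is_derive q u g ('D_u psi (q + h *: v) - 'D_u psi q).
  have dp : is_derive q u psi ('D_u psi q).
    by apply: derivableP; exact: smooth_derivable.
  have ds : is_derive q u (fun q => psi (q + h *: v)) ('D_u psi (q + h *: v)).
    have X : (fun k : R => k^-1 *: (((fun q => psi (q + h *: v)) \o shift q) (k *: u)
      - psi (q + h *: v))) =
      (fun k => k^-1 *: ((psi \o shift (q + h *: v)) (k *: u) - psi (q + h *: v))).
      by apply/funext => k /=; rewrite addrA.
    apply: DeriveDef; rewrite /derivable /derive X //.
    exact: smooth_derivable.
  exact: is_deriveB.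
have [|s hs Es] := @mvt_line g p u h h0; first by move=> q; case: (E q).
have [|t ht Et] := @mvt_line ('D_u psi) (p + s *: u) v h h0.
  by move=> q; apply: smooth_derivable; exact: smooth_derive.
exists s, t; split => //; rewrite -Et -[in RHS](@derive_val _ _ _ _ _ _ _ (E _)).
by rewrite -Es.
Qed.

(** Continuity carries to [p] an equality known only between values at two different nearby points,
    which is all the mean value theorem gives for the two mixed derivatives. *)
Lemma eq_limit_points (F G : V -> R) p : {for p, continuous F} ->
  {for p, continuous G} ->
  (forall d : R, 0 < d ->
    exists q q', [/\ `|p - q| < d, `|p - q'| < d & F q = G q']) ->
  F p = G p.
Proof.
move=> cF cG FG.
apply/eqP; rewrite -subr_eq0 -normr_le0; apply/ler_addgt0Pl => e e0.
rewrite addr0; have e2 : 0 < e / 2 by rewrite divr_gt0.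
have /(_ _ _ e2)/nbhs_normP[d1 /= d10 B1] := (cvgrPdist_lt _ _).1 cF.
have /(_ _ _ e2)/nbhs_normP[d2 /= d20 B2] := (cvgrPdist_lt _ _).1 cG.
have d0 : 0 < Num.min d1 d2 by rewrite lt_min d10.
have [q [q' []]] := FG _ d0; rewrite !lt_min => /andP[q1 _] /andP[_ q2] E.
rewrite (le_trans (ler_distD (F q) _ _))// [e]splitr lerD// ?ltW//.
  exact: B1.
by rewrite E distrC; apply: B2.
Qed.

Lemma shift_small u v (d : R) : 0 < d -> exists2 h : R, 0 < h &
  forall p (a b : R), 0 < a < h -> 0 < b < h ->
    `|p - (p + a *: u + b *: v)| < d.
Proof.
move=> d0; pose N := `|u| + `|v| + 1; have N0 : 0 < N.
  by rewrite ltr_wpDl // addr_ge0.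
(* The summand 1 in [N] allows [u] and [v] to be zero and makes the final bound strict. *)
exists (d / N); first by rewrite divr_gt0.
move=> p a b /andP[a0 ah] /andP[b0 bh].
rewrite -addrA opprD addNKr normrN (le_lt_trans (ler_normD _ _))//.
rewrite !normrZ !gtr0_norm//.
have : a * `|u| + b * `|v| <= d / N * (`|u| + `|v|).
  by rewrite mulrDr lerD// ler_wpM2r// ltW.
move=> /le_lt_trans; apply.
by rewrite mulrAC ltr_pdivrMr// ltr_pM2l// ltrDl.
Qed.

Lemma smooth_deriveC psi u v : smooth psi -> 'D_u ('D_v psi) = 'D_v ('D_u psi).
Proof.
move=> sp; apply/funext => p.
apply: (@eq_limit_points ('D_u ('D_v psi)) ('D_v ('D_u psi)) p).
- exact: ((sp [:: u; v]).1 p).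
- exact: ((sp [:: v; u]).1 p).
move=> d d0; have [h h0 hd] := shift_small u v d0.
have [h' h'0 hd'] := shift_small v u d0.
(* One step size serves both orders: the second difference is symmetric in [u] and [v], so both
   mixed values, times the squared step, equal the same number. *)
have k0 : 0 < Num.min h h' by rewrite lt_min h0.
have [s [t [hs ht E1]]] := second_difference p u v sp k0.
have [s' [t' [hs' ht' E2]]] := second_difference p v u sp k0.
move: hs ht hs' ht'; rewrite !lt_min.
move=> /and3P[s0 sh _] /and3P[t0 th _] /and3P[s'0 _ sh'] /and3P[t'0 _ th'].
exists (p + s' *: v + t' *: u), (p + s *: u + t *: v); split.
- by apply: hd'; apply/andP.
- by apply: hd; apply/andP.
apply: (mulIf (lt0r_neq0 k0)); apply: (mulIf (lt0r_neq0 k0)).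
apply: (etrans (esym E2)); apply: (etrans _ E1).
rewrite [p + _ *: v + _]addrAC.
move: (psi _) (psi _) (psi _) (psi _) => *; ring.
Qed.

(** The two signs from the duality cancel, which leaves Schwarz's theorem for the test function. *)
Lemma dist_deriveC U u v (T : dist U) :
  dist_derive u (dist_derive v T) = dist_derive v (dist_derive u T).
Proof.
apply: val_inj; apply/funext => psi /=; rewrite !opprK; congr (T _).
by apply: val_inj; apply: smooth_deriveC; have [] := testfunP psi.
Qed.

Lemma testfun_derive_affine (U : set V) v (a : R) (psi eta : testfun U) :
  testfun_derive v (a *: psi + eta) =
  a *: testfun_derive v psi + testfun_derive v eta.
Proof.
apply: val_inj; have [s _ _] := testfunP psi; have [t _ _] := testfunP eta.
exact: (iterDP [:: v] a s t).
Qed.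

Lemma dist_derive_linear U v : linear (@dist_derive R V U v).
Proof.
move=> a S T; apply: val_inj; apply/funext => psi /=.
exact: (etrans (opprD _ _) (congr1 (+%R^~ _) (esym (mulrN _ _)))).
Qed.

HB.instance Definition _ U v := GRing.isLinear.Build R (dist U) (dist U) _
  (@dist_derive R V U v) (@dist_derive_linear U v).

End Schwarz.

(** * Locally integrable functions and multiplication of regular distributions *)

Section LocallyIntegrable.
Context {R : realType}.
Local Notation mu2 := (@lebesgue_measure R \x @lebesgue_measure R)%E.
Local Notation RR := (measurableTypeR R * measurableTypeR R)%type.
Implicit Types (Omega K : set (R * R)) (g h m : R * R -> R) (a M : R).

Lemma loc_integrable_compact Omega g K : loc_integrable Omega g ->
  compact K -> K `<=` Omega -> mu2.-integrable K (EFin \o g).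
Proof.
move=> [mg oO ig] cK KO; apply/integrableP; split; last exact: ig.
apply/measurable_EFinP; apply: (measurable_funS (_ : measurable (Omega : set RR)) KO) => //.
exact: open_measurable2.
Qed.

Lemma loc_integrableP Omega a g h : loc_integrable Omega g ->
  loc_integrable Omega h -> loc_integrable Omega (a *: g + h).
Proof.
move=> lg lh; have [mg oO _] := lg; have [mh _ _] := lh; split => //.
  exact: (measurable_funD (measurable_funM (measurable_cst a) mg) mh).
move=> K KO cK; have mK : measurable (K : set RR) := compact_measurable2 cK.
have ig := loc_integrable_compact lg cK KO.
have ih := loc_integrable_compact lh cK KO.
by case/integrableP: (integrableD mK (integrableZl mK a ig) ih).
Qed.

Lemma loc_integrableM Omega m g M : measurable_fun Omega m ->
  (forall p, Omega p -> `|m p| <= M) -> loc_integrable Omega g ->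
  loc_integrable Omega (m \* g).
Proof.
move=> mm mM lg; have [mg oO _] := lg; split => //.
  exact: measurable_funM.
have mO : measurable (Omega : set RR) := open_measurable2 oO.
move=> K KO cK; have mK : measurable (K : set RR) := compact_measurable2 cK.
(* The dominating function is [|M * g|]; the sign of [M] is not known when [Omega] is empty, hence
   the absolute value. *)
have ig := integrable_norm (integrableZl mK M (loc_integrable_compact lg cK KO)).
case/integrableP: (ig) => _; apply: le_lt_trans.
have mgK := measurable_funS mO KO (measurable_funM mm mg).
apply: ge0_le_integral => //.
- by apply/measurable_EFinP; apply: measurableT_comp.
- by case/integrableP: ig => mi _; apply: measurableT_comp.
- move=> p Kp; rewrite /= lee_fin normr_id !normrM ler_wpM2r//.
  by rewrite (le_trans (mM _ (KO _ Kp)))// ler_norm.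
Qed.

Lemma fun_distP Omega a g h :
  loc_integrable Omega g -> loc_integrable Omega h ->
  fun_dist Omega (a *: g + h) = a *: fun_dist Omega g + fun_dist Omega h.
Proof.
move=> lg lh; apply: val_inj; apply/funext => psi.
have [_ oO _] := lg.
have mO : measurable (Omega : set RR) := open_measurable2 oO.
rewrite (_ : \val (_ + _) psi = a * fun_dist Omega g psi + fun_dist Omega h psi)//.
rewrite [LHS]fun_distE; last exact: loc_integrableP.
rewrite !fun_distE// -RintegralZl//; last exact: loc_integrable_test.
rewrite -RintegralD//; first last.
- exact: loc_integrable_test.
- exact: (integrableZl mO a (loc_integrable_test psi lg)).
by apply: eq_Rintegral => p _; rewrite -[(a *: g + h) p]/(a * g p + h p); ring.
Qed.

Lemma regularP Omega a (S T : dist Omega) : regular S -> regular T ->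
  regular (a *: S + T).
Proof.
move=> [g lg ->] [h lh ->]; exists (a *: g + h); first exact: loc_integrableP.
by rewrite fun_distP.
Qed.

(** Regularity makes the set from which [xget] chooses inhabited, so the choice is a genuine density
    and not the default zero function. *)
Lemma regular_density Omega (T : dist Omega) : regular T ->
  loc_integrable Omega (density T) /\ T = fun_dist Omega (density T).
Proof.
move=> [g lg Tg].
exact: (@xgetPex _ (cst 0) [set g | loc_integrable Omega g /\ T = fun_dist Omega g]
  (ex_intro _ g (conj lg Tg))).
Qed.

(** With a density [g] of [T] this is the pointwise identity (1 + a m) g = g + a (m g). Without a
    density, [mult] would return 0 and the summand [T] would be lost. *)
Lemma mult_affine Omega a m M (T : dist Omega) : measurable_fun Omega m ->
  (forall p, Omega p -> `|m p| <= M) -> regular T ->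
  mult (fun p => 1 + a * m p) T = T + a *: mult m T.
Proof.
move=> mm mM /regular_density[ld Td]; rewrite [in RHS]addrC [X in _ + X]Td.
rewrite /mult -fun_distP//; last exact: loc_integrableM mM _.
congr fun_dist; apply/funext => p /=.
by rewrite -[RHS]/(a * (m p * density T p) + density T p); ring.
Qed.

End LocallyIntegrable.

(** * The identity R A = D R and the harmonicity of the kernel of R *)

Section Intertwining.
Context {R : realType} {Omega : set (R * R)}.
Implicit Types (T : dist Omega) (U : dist Omega * dist Omega).

HB.instance Definition _ := GRing.isLinear.Build R (dist Omega) (dist Omega) _
  (@dx R Omega) (@dist_derive_linear R _ Omega (1, 0)).
HB.instance Definition _ := GRing.isLinear.Build R (dist Omega) (dist Omega) _
  (@dy R Omega) (@dist_derive_linear R _ Omega (0, 1)).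

Lemma dydx T : dy (dx T) = dx (dy T).
Proof. exact: dist_deriveC. Qed.

Lemma flow_op_diagonal (a : R) (m : R * R -> R) (M : R) U :
  measurable_fun Omega m ->
  (forall p, Omega p -> `|m p| <= M) -> regular (divergence U) ->
  cauchy_riemann (flow_op a m U) =
  diagonal_op (fun p => 1 + a * m p) (cauchy_riemann U).
Proof.
move=> mm mM rU; rewrite /cauchy_riemann /diagonal_op /operator_matrix /=.
rewrite -/(divergence U) (mult_affine a mm mM rU) /divergence.
set S := mult _ _; congr (_, _); rewrite /laplacian !linearD/= ?linearN/= !linearZ/=.
  (* Curl row: the mixed derivatives of [S] occur with opposite signs. *)
  by rewrite !dydx addr0 scalerN addrACA subrr addr0 addrACA.
(* Divergence row: the terms in [S] form [a *: laplacian S], and the others the Laplacian of the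
   divergence. *)
by rewrite !dydx add0r addrACA [RHS]addrACA; congr (_ + _); rewrite addrACA.
Qed.

(** For U = (u, v) one has Delta u = dx (div U) + dy (curl U) and Delta v = dy (div U) - dx (curl
    U). *)
Lemma laplacian_eq0 U : curl U = 0 -> divergence U = 0 ->
  laplacian U.1 = 0 /\ laplacian U.2 = 0.
Proof.
rewrite /curl /divergence => c0 d0.
have : dx (dx U.1 + dy U.2) = 0 by rewrite d0 linear0.
have : dy (dx U.1 + dy U.2) = 0 by rewrite d0 linear0.
have : dx (dy U.1 - dx U.2) = 0 by rewrite c0 linear0.
have : dy (dy U.1 - dx U.2) = 0 by rewrite c0 linear0.
rewrite !linearD/= !linearN/= !dydx => e1 e2 e3 e4.
by rewrite /laplacian (subr0_eq e1) e4 -(subr0_eq e2) e3.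
Qed.

End Intertwining.

(** * Weak derivatives in time *)

Section TimeDerivative.
Context {R : realType} {Omega : set (R * R)}.
Local Notation mu := (@lebesgue_measure R).
Local Notation pos := (`]0, +oo[%classic : set R).
Implicit Types (w : R -> dist Omega) (g : R -> R).

Lemma testfun_bounded (V : normedModType R) (U : set V) (eta : testfun U) :
  exists M, forall t, `|eta t| <= M.
Proof.
have [s c _] := testfunP eta; have ceta : continuous eta := (s [::]).1.
have : compact (eta @` supp eta).
  by apply: continuous_compact => //; exact: continuous_subspaceT.
move=> /compact_bounded [M [_ /(_ (M + 1))]]; rewrite ltrDl => /(_ ltr01) h.
(* [compact_bounded] bounds the image by any number above [M], hence [M + 1]; the 0 covers the
   points outside the support. *)
exists (Num.max 0 (M + 1)) => p; rewrite le_max.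
have [/supp_eq0 ->|np] := pselect (~ supp eta p); first by rewrite normr0 lexx.
by rewrite h ?orbT//; exists p => //; exact: contrapT.
Qed.

(** On the compact support of [eta], [g] is integrable and [eta] bounded; elsewhere the product
    vanishes. This gives the integrability that additivity of the integral requires below. *)
Lemma locally_integrable_test (U : set R) g (eta : testfun U) :
  locally_integrable U g -> mu.-integrable U (EFin \o (g \* eta)).
Proof.
move=> [mg oU ig]; have [s c sU] := testfunP eta.
have mU : measurable (U : set (measurableTypeR R)) by exact: open_measurable.
have mK : measurable (supp eta : set (measurableTypeR R)).
  exact: compact_measurable.
have [M etaM] := testfun_bounded eta.
have mh : measurable_fun U (g \* eta).
  apply: measurable_funM => //; apply: measurable_funTS.
  by apply: continuous_measurable_fun; exact: (s [::]).1.
have igK : mu.-integrable (supp eta) (EFin \o g).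
  apply/integrableP; split; last exact: ig.
  by apply/measurable_EFinP; exact: measurable_funS mg.
have : mu.-integrable (supp eta) (EFin \o (g \* eta)).
  have igM := integrable_norm (integrableZl mK M igK).
  apply: (le_integrable mK _ _ igM).
    by apply/measurable_EFinP; exact: measurable_funS mh.
  move=> t _; rewrite /= lee_fin normr_id !normrM mulrC ler_wpM2r//.
  by rewrite (le_trans (etaM t))// ler_norm.
move=> /(integrable_mkcond _ mK) i; apply/(integrable_mkcond _ mU).
rewrite (_ : _ \_ U = (EFin \o (g \* eta)) \_ (supp eta))//.
apply/funext => t; rewrite !patchE; case: ifPn => [_|tU]; case: ifPn => // tK.
  by move: tK; rewrite notin_setE => /supp_eq0 /= ->; rewrite mulr0.
by move: tK tU; rewrite inE => /sU/mem_set ->.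
Qed.

Lemma time_derivativeD w1 w1' w2 w2' :
  time_derivative w1 w1' -> time_derivative w2 w2' ->
  time_derivative (fun t => w1 t + w2 t) (fun t => w1' t + w2' t).
Proof.
move=> h1 h2 psi; have [l1 l1' e1] := h1 psi; have [l2 l2' e2] := h2 psi.
have mp : measurable pos by exact: measurable_itv.
split; [exact: locally_integrableD|exact: locally_integrableD|move=> eta].
pose eta' := testfun_derive (1 : R) eta.
have -> : \int[mu]_(t in pos) ((w1 t + w2 t) psi * 'D_1 eta t) =
  \int[mu]_(t in pos) (w1 t psi * eta' t + w2 t psi * eta' t).
  by apply: eq_Rintegral => t _; rewrite -mulrDl.
rewrite RintegralD//; first last.
- exact: (locally_integrable_test eta' l2).
- exact: (locally_integrable_test eta' l1).
have -> : \int[mu]_(t in pos) ((w1' t + w2' t) psi * eta t) =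
  \int[mu]_(t in pos) (w1' t psi * eta t + w2' t psi * eta t).
  by apply: eq_Rintegral => t _; rewrite -mulrDl.
rewrite RintegralD//; first last.
- exact: (locally_integrable_test eta l2').
- exact: (locally_integrable_test eta l1').
by rewrite opprD -e1 -e2.
Qed.

Lemma time_derivativeN w w' : time_derivative w w' ->
  time_derivative (fun t => - w t) (fun t => - w' t).
Proof.
move=> h psi; have [l l' e] := h psi.
have mp : measurable pos by exact: measurable_itv.
split; [exact: locally_integrableN|exact: locally_integrableN|move=> eta].
pose eta' := testfun_derive (1 : R) eta.
have -> : \int[mu]_(t in pos) ((- w t) psi * 'D_1 eta t) =
  \int[mu]_(t in pos) (-1 * (w t psi * eta' t)).
  by apply: eq_Rintegral => t _; rewrite mulN1r -mulNr.
rewrite RintegralZl//; last exact: (locally_integrable_test eta' l).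
have -> : \int[mu]_(t in pos) ((- w' t) psi * eta t) =
  \int[mu]_(t in pos) (-1 * (w' t psi * eta t)).
  by apply: eq_Rintegral => t _; rewrite mulN1r -mulNr.
rewrite RintegralZl//; last exact: (locally_integrable_test eta l').
by rewrite [X in _ * X]e mulrN.
Qed.

(** A derivative in space acts on the test function [psi], which does not depend on time, so the
    claim is the negated equation tested against [testfun_derive v psi]. *)
Lemma time_derivative_derive v w w' : time_derivative w w' ->
  time_derivative (fun t => dist_derive v (w t)) (fun t => dist_derive v (w' t)).
Proof. by move=> h psi; exact: (time_derivativeN h (testfun_derive v psi)). Qed.

(** The weak derivative sees positive times only. The identity R A U = D R U will be available
    exactly there, since the boundary condition is imposed for [0 < t]. *)
Lemma time_derivative_eq w1 w1' w2 w2' :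
  (forall t, 0 < t -> w1 t = w2 t) -> (forall t, 0 < t -> w1' t = w2' t) ->
  time_derivative w1 w1' -> time_derivative w2 w2'.
Proof.
have li (f g : R -> R) : {in pos, f =1 g} ->
    locally_integrable pos f -> locally_integrable pos g.
  move=> fg [mf oD ig]; split => //; first exact: eq_measurable_fun mf.
  move=> K KD cK; have := ig K KD cK.
  congr (_ < _)%E; apply: eq_integral => t /set_mem/KD/mem_set/fg -> //.
move=> e e' h psi; have [l l' i] := h psi.
have {}e : {in pos, (fun t => w1 t psi) =1 (fun t => w2 t psi)}.
  by move=> t; rewrite inE/= in_itv/= andbT => /e ->.
have {}e' : {in pos, (fun t => w1' t psi) =1 (fun t => w2' t psi)}.
  by move=> t; rewrite inE/= in_itv/= andbT => /e' ->.
split; [exact: li e l|exact: li e' l'|move=> eta].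
have <- : \int[mu]_(t in pos) (w1 t psi * 'D_1 eta t) =
  \int[mu]_(t in pos) (w2 t psi * 'D_1 eta t).
  by apply: eq_Rintegral => t /e /= ->.
have <- : \int[mu]_(t in pos) (w1' t psi * eta t) =
  \int[mu]_(t in pos) (w2' t psi * eta t).
  by apply: eq_Rintegral => t /e' /= ->.
exact: i.
Qed.

End TimeDerivative.

(** * Integrals of compactly supported functions and of their derivatives *)

Section CompactSupport.
Context {R : realType}.
Local Notation mu := (@lebesgue_measure R).
Local Notation mu2 := (@lebesgue_measure R \x @lebesgue_measure R)%E.
Local Notation RR := (measurableTypeR R * measurableTypeR R)%type.
Implicit Types (Omega K : set (R * R)) (g h k : R * R -> R).

(** The norm of the product space is the maximum norm, so one bound controls both coordinates. *)
Lemma bounded_set_prod Omega : bounded_set Omega ->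
  exists2 M : R, 0 < M & forall p, Omega p -> `|p.1| <= M /\ `|p.2| <= M.
Proof.
move=> [M [_ h]]; exists (Num.max 1 (M + 1)); first by rewrite lt_max ltr01.
move=> p /(h (Num.max 1 (M + 1))) /=; rewrite lt_max ltrDl ltr01 orbT => /(_ isT).
by rewrite prod_normE ge_max => /andP[].
Qed.

Lemma compact_measure_lty K : compact K -> (mu2 (K : set RR) < +oo)%E.
Proof.
move=> cK; have [M M0 KM] := bounded_set_prod (compact_bounded cK).
have mI : measurable (`[- M, M]%classic : set (measurableTypeR R)) by [].
have KI : K `<=` `[- M, M]%classic `*` `[- M, M]%classic.
  by move=> p /KM[p1 p2]; split; rewrite /= in_itv/= -ler_norml.
apply: (@le_lt_trans _ _ (mu2 (`[- M, M]%classic `*` `[- M, M]%classic : set RR))).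
  apply: le_measure; rewrite ?inE//; first exact: compact_measurable2.
  exact: measurableX.
rewrite product_measure1E//.
have If : (mu `[(- M)%R, M]%classic < +oo)%E.
  by rewrite lebesgue_measure_itv/=; case: ifPn => _; rewrite -?EFinB ltry.
by apply: lte_mul_pinfty; [|rewrite ge0_fin_numE|].
Qed.

Lemma continuous_compact_supp_integrable Omega K k :
  measurable (Omega : set RR) -> compact K -> continuous k -> (forall p, ~ K p -> k p = 0) ->
  mu2.-integrable Omega (EFin \o k).
Proof.
move=> mO cK ck k0; have mK : measurable (K : set RR) := compact_measurable2 cK.
have mk : measurable_fun [set: R * R] k.
  apply: continuous_measurable_fun2 => //.
have /compact_bounded[M [_ /(_ (M + 1))]] : compact (k @` K).
  by apply: continuous_compact => //; exact: continuous_subspaceT.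
rewrite ltrDl => /(_ ltr01) kM.
have : mu2.-integrable K (EFin \o k).
  have i1 : mu2.-integrable K (EFin \o cst (M + 1)).
    apply/integrableP; split.
      by apply/measurable_EFinP; exact: measurable_cst.
    rewrite [X in (X < _)%E](integral_cst mu2 mK `|M + 1|%:E).
    apply: lte_mul_pinfty => //.
    exact: compact_measure_lty.
  apply: (le_integrable mK _ _ i1).
    by apply/measurable_EFinP; exact: measurable_funTS.
  move=> p Kp; rewrite /= lee_fin (le_trans _ (ler_norm _))//.
  by apply: kM; exists p.
move=> /(integrable_mkcond _ mK) i.
apply: (integrableS measurableT) => //.
apply/(integrable_mkcond _ measurableT).
rewrite (_ : _ \_ _ = (EFin \o k) \_ K)//.
apply/funext => p; rewrite !patchE in_setT; case: ifPn => //.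
by rewrite notin_setE => /k0 /= ->.
Qed.

Lemma Rintegral_lines_eq0 k : mu2.-integrable setT (EFin \o k) ->
  (forall y, (\int[mu]_x (k (x, y))%:E = 0)%E) -> \int[mu2]_p k p = 0.
Proof.
move=> i k0; rewrite /Rintegral -(integral21_prod_meas1 i).
by rewrite integral0_eq// => y _; exact: k0.
Qed.

(* By Fubini, the integral of a derivative in x is computed on lines, where it
   vanishes by the fundamental theorem of calculus. *)
Lemma integral_derive_compact_supp h k : continuous h -> continuous k ->
  (forall p, is_derive p ((1, 0) : R * R) h (k p)) ->
  compact (supp h) -> \int[mu2]_p k p = 0.
Proof.
move=> ch ck dh cs; have [M M0 sM] := bounded_set_prod (compact_bounded cs).
have z p : M < `|p.1| -> ~ supp h p.
  by move=> Mp /sM[]; rewrite leNgt Mp.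
have hz p : M < `|p.1| -> h p = 0 by move=> /z; exact: supp_eq0.
have dz p : ~ supp h p -> k p = 0.
  move=> np; have [_ <-] := dh p.
  exact: (supp_eq0 (contra_not (@supp_derive R _ ((1, 0) : R * R) h p) np)).
apply: Rintegral_lines_eq0 => [|y].
  exact: (continuous_compact_supp_integrable measurableT cs ck dz).
(* The segment from [- N] to [N] reaches strictly past the support, so [h] vanishes at both of its
   ends. *)
pose N := M + 1; have MN : M < N by rewrite ltrDl.
have N0 : 0 < N by apply: lt_trans MN.
have lineE (x : R) : (x, y) = (0, y) + x *: ((1, 0) : R * R).
  by congr (_, _) => /=; [rewrite add0r [RHS]mulr1|rewrite scaler0 addr0].
have dline (x : R) : is_derive x 1 (fun x => h (x, y)) (k (x, y)).
  have -> : (fun x => h (x, y)) = (fun x => h ((0, y) + x *: ((1, 0) : R * R))).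
    by apply/funext => t; rewrite -lineE.
  have [dx dk] := dh (x, y).
  by rewrite -dk (lineE x); apply: is_derive_line; rewrite -lineE.
have cl g : continuous g -> continuous (fun x => g (x, y)).
  move=> cg x; apply: (continuous_comp (g := g) (f := fun x => (x, y))).
    apply: (@cvg_pair R R R (nbhs x) (nbhs x) (nbhs y) _ _ _ id (cst y)).
      exact: cvg_id.
    exact: cvg_cst.
  exact: cg.
have clh := cl _ ch; have cld := cl _ ck.
transitivity (\int[mu]_(x in `[(- N)%R, N]) (k (x, y))%:E)%E.
  rewrite [RHS]integral_mkcond; apply: eq_integral => x _.
  rewrite patchE; case: ifPn => //; rewrite notin_setE /= in_itv/= -ler_norml.
  by move=> /negP; rewrite -ltNge => Nx; rewrite dz//; apply: z; apply: lt_trans Nx.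
rewrite (@continuous_FTC2 _ _ (fun x => h (x, y))).
- by rewrite !hz ?subee//= ?normrN gtr0_norm.
- by rewrite gtrN.
- exact: continuous_subspaceT.
- split.
  + by move=> x _; case: (dline x).
  + exact/cvg_at_right_filter/clh.
  + exact/cvg_at_left_filter/clh.
- by move=> x _; rewrite derive1E; apply: derive_val.
Qed.

End CompactSupport.

(** * Square integrable functions and L2 convergence *)

Section SquareIntegrable.
Context {R : realType} (Omega : set (R * R)) (oO : open Omega).
Local Notation mu2 := (@lebesgue_measure R \x @lebesgue_measure R)%E.
Local Notation RR := (measurableTypeR R * measurableTypeR R)%type.
Local Notation I f := (\int[mu2]_(p in Omega) f p).
Implicit Types (f g h k : R * R -> R) (psi : testfun Omega) (c : R).

Let mO : measurable (Omega : set RR).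
Proof. exact: open_measurable2. Qed.

Lemma integrable_affine c f g : mu2.-integrable Omega (EFin \o f) ->
  mu2.-integrable Omega (EFin \o g) ->
  mu2.-integrable Omega (EFin \o (fun p => c * f p + g p)).
Proof. by move=> i j; exact: (integrableD mO (integrableZl mO c i) j). Qed.

Lemma Rintegral_affine c f g : mu2.-integrable Omega (EFin \o f) ->
  mu2.-integrable Omega (EFin \o g) ->
  I (fun p => c * f p + g p) = c * I f + I g.
Proof.
move=> i j; rewrite (RintegralD mO (integrableZl mO c i) j).
by rewrite RintegralZl.
Qed.

Lemma square_integrableE f : square_integrable Omega f <->
  measurable_fun Omega f /\
  mu2.-integrable Omega (EFin \o (fun p => f p ^+ 2)).
Proof.
have E : (\int[mu2]_(p in Omega) (f p ^+ 2)%:E =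
    \int[mu2]_(p in Omega) `|(EFin \o (fun p => f p ^+ 2)%R) p|)%E.
  by apply: eq_integral => p _ /=; rewrite ger0_norm// sqr_ge0.
split=> [[mf fi]|[mf /integrableP[_ fi]]]; split => //; last by rewrite E.
apply/integrableP; split; last by rewrite -E.
by apply/measurable_EFinP; exact: measurable_funX.
Qed.

(** The product is dominated by f^2 + g^2, because (f + g)^2 and (f - g)^2 are nonnegative. *)
Lemma integrable_mul f g : square_integrable Omega f ->
  square_integrable Omega g ->
  mu2.-integrable Omega (EFin \o (fun p => f p * g p)).
Proof.
move=> /square_integrableE[mf fi] /square_integrableE[mg gi].
have fgi := integrable_affine 1 fi gi.
apply: (le_integrable mO _ _ fgi).
  by apply/measurable_EFinP; exact: measurable_funM.
move=> p _; rewrite /= lee_fin (le_trans _ (ler_norm _))// mul1r.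
rewrite ler_norml; apply/andP; split.
  by have := sqr_ge0 (f p + g p); have := sqr_ge0 (f p); have := sqr_ge0 (g p); lra.
by have := sqr_ge0 (f p - g p); have := sqr_ge0 (f p); have := sqr_ge0 (g p); lra.
Qed.

Lemma square_integrableP c f g : square_integrable Omega f ->
  square_integrable Omega g -> square_integrable Omega (c *: f + g).
Proof.
move=> sf sg; have fgi := integrable_mul sf sg.
have /square_integrableE[mf fi] := sf; have /square_integrableE[mg gi] := sg.
apply/square_integrableE; split.
  exact: (measurable_funD (measurable_funM (measurable_cst c) mf) mg).
have := integrable_affine (c ^+ 2) fi (integrable_affine (2 * c) fgi gi).
congr (mu2.-integrable _ _); apply/funext => p /=; congr _%:E.
by rewrite -[(c *: f + g) p]/(c * f p + g p); ring.
Qed.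

(** On a compact set, which has finite measure, |f| is dominated by 1 + f^2. *)
Lemma square_integrable_loc f : square_integrable Omega f ->
  loc_integrable Omega f.
Proof.
move=> /square_integrableE[mf fi]; split => // K KO cK.
have mK : measurable (K : set RR) := compact_measurable2 cK.
have i1 : mu2.-integrable K (EFin \o cst (1 : R)).
  apply/integrableP; split; first by apply/measurable_EFinP; exact: measurable_cst.
  rewrite [X in (X < _)%E](integral_cst mu2 mK `|1|%:E).
  by apply: lte_mul_pinfty => //; exact: compact_measure_lty.
have := integrableD mK i1 (integrableS mO mK KO fi).
move=> /integrableP[_]; apply: le_lt_trans.
have mfK : measurable_fun K f := measurable_funS mO KO mf.
apply: ge0_le_integral => //.
- by apply/measurable_EFinP; apply: measurableT_comp.
- apply/measurable_EFinP; apply: measurableT_comp => //.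
  by apply: measurable_funD; [exact: measurable_cst|exact: measurable_funX].
- move=> p _ /=; rewrite lee_fin (le_trans _ (ler_norm _))// ler_norml.
  apply/andP; split.
    by have := sqr_ge0 (f p + 1); have := sqr_ge0 (f p); lra.
  by have := sqr_ge0 (f p - 1); have := sqr_ge0 (f p); lra.
Qed.

Lemma testfun_integrable psi k : continuous k ->
  (forall p, ~ supp psi p -> k p = 0) -> mu2.-integrable Omega (EFin \o k).
Proof.
have [_ cs _] := testfunP psi => ck k0.
exact: (continuous_compact_supp_integrable mO cs).
Qed.

Lemma testfun_square_integrable psi : square_integrable Omega psi.
Proof.
have [s _ _] := testfunP psi; have cpsi : continuous psi := (s [::]).1.
apply/square_integrableE; split; first exact: continuous_measurable_fun2.
apply: (@testfun_integrable psi) => [p|p /supp_eq0 ->]; last by rewrite expr0n.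
exact: (cvgM (cpsi p) (cpsi p)).
Qed.

Lemma Rintegral_sqr_ge0 f : 0 <= I (fun p => f p ^+ 2).
Proof. by apply: Rintegral_ge0 => p _; exact: sqr_ge0. Qed.

(* If I (f h) were nonzero, I ((c f - h)^2) would be negative for some c. *)
Lemma Rintegral_mul_eq0 f h : square_integrable Omega f ->
  square_integrable Omega h -> I (fun p => f p ^+ 2) = 0 ->
  I (fun p => f p * h p) = 0.
Proof.
move=> sf sh f0; have fhi := integrable_mul sf sh.
have /square_integrableE[mf fi] := sf; have /square_integrableE[mh hi] := sh.
apply/eqP; apply/negPn/negP => nz.
have ge0 c : 0 <= c * I (fun p => f p * h p) + I (fun p => h p ^+ 2).
  have -> : c * I (fun p => f p * h p) + I (fun p => h p ^+ 2) =
      I (fun p => (c / 2 * f p + h p) ^+ 2).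
    (* Since I (f^2) = 0, the term (c / 2)^2 I (f^2) can be inserted to complete the square. *)
    rewrite -(Rintegral_affine c fhi hi) -[LHS]add0r.
    rewrite -[X in X + _](mulr0 ((c / 2) ^+ 2)) -f0.
    rewrite -(Rintegral_affine _ fi (integrable_affine c fhi hi)).
    by apply: eq_Rintegral => p _; field.
  by apply: Rintegral_ge0 => p _; exact: sqr_ge0.
(* For this [c] the affine expression in [c] takes the value -1. *)
have := ge0 (- (I (fun p => h p ^+ 2) + 1) / I (fun p => f p * h p)).
by rewrite divfK// opprD addrAC addNr add0r ler0N1.
Qed.

Lemma L2_cvgE (h : nat -> R * R -> R) g : square_integrable Omega g ->
  (forall n, square_integrable Omega (h n)) ->
  L2_cvg Omega h g <-> I (fun p => (h n p - g p) ^+ 2) @[n --> \oo] --> (0 : R).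
Proof.
move=> sg sh; rewrite /L2_cvg.
have E n : (\int[mu2]_(p in Omega) ((h n p - g p) ^+ 2)%:E =
    (I (fun p => (h n p - g p) ^+ 2))%:E)%E.
  rewrite /Rintegral fineK//; apply: integrable_fin_num => //.
  have /square_integrableE[_] := square_integrableP (-1) sg (sh n).
  congr (mu2.-integrable _ _); apply/funext => p /=; congr _%:E.
  by rewrite -[(_ + _) p]/(-1 * g p + h n p); ring.
under eq_fun do rewrite E.
by split => [/fine_cvg//|c0]; apply: cvg_EFin => //; exact: nearW.
Qed.

End SquareIntegrable.

(** * The Poincare inequality for test functions *)

Section Poincare.
Context {R : realType} (Omega : set (R * R)) (oO : open Omega).
Local Notation mu2 := (@lebesgue_measure R \x @lebesgue_measure R)%E.
Local Notation RR := (measurableTypeR R * measurableTypeR R)%type.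
Local Notation I f := (\int[mu2]_(p in Omega) f p).
Local Notation e1 := ((1, 0) : R * R).
Implicit Types (psi : testfun Omega).

Let mO : measurable (Omega : set RR).
Proof. exact: open_measurable2. Qed.

Lemma is_derive_fst (p : R * R) : is_derive p e1 (fst : R * R -> R) 1.
Proof.
have c1 : h^-1 *: (((fst : R * R -> R) \o shift p) (h *: e1) - p.1)
    @[h --> (0 : R)^'] --> (1 : R).
  apply: cvg_near_cst; near=> h => /=.
  have h0 : h != 0 by near: h; exact: nbhs_dnbhs_neq.
  by rewrite addrK [h *: 1]mulr1 [_ *: _]mulVf.
by apply: DeriveDef; [apply/cvg_ex; exists 1|exact/cvg_lim].
Unshelve. all: by end_near.
Qed.

Lemma is_derive_testfun psi v (p : R * R) :
  is_derive p v psi (testfun_derive v psi p).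
Proof.
have [s _ _] := testfunP psi.
by apply: derivableP; exact: smooth_derivable.
Qed.

Lemma testfun_continuous psi : continuous psi.
Proof. by have [/smooth_continuous] := testfunP psi. Qed.

(* The derivative in x of x psi^2 has integral 0, which bounds the integral of
   psi^2 by that of - 2 x psi (dpsi/dx). *)
Lemma poincare (M : R) psi : (forall p, Omega p -> `|p.1| <= M) ->
  I (fun p => psi p ^+ 2) <=
  4 * M ^+ 2 * I (fun p => testfun_derive e1 psi p ^+ 2).
Proof.
move=> OM; set d := testfun_derive e1 psi.
pose h (p : R * R) := p.1 * (psi p * psi p).
pose k (p : R * R) := 2 * p.1 * psi p * d p + psi p ^+ 2.
have cpsi : continuous psi by exact: testfun_continuous.
have cd : continuous d by exact: testfun_continuous.
have [_ cs sO] := testfunP psi.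
have ch : continuous h.
  by move=> p; apply: cvgM; [exact: cvg_fst|apply: cvgM; exact: cpsi].
have ck : continuous k.
  move=> p; apply: cvgD; last by apply: cvgM; exact: cpsi.
  apply: cvgM; last exact: cd.
  apply: cvgM; last exact: cpsi.
  by apply: cvgM; [exact: cvg_cst|exact: cvg_fst].
have dh p : is_derive p e1 h (k p).
  have dpsi := is_derive_testfun psi e1 p; have dfst := is_derive_fst p.
  apply: is_derive_eq (is_deriveM dfst (is_deriveM dpsi dpsi)) _.
  rewrite /k -/d.
  by rewrite -[LHS]/(p.1 * (psi p * d p + psi p * d p) + psi p * psi p * 1); ring.
have k0 p : ~ supp psi p -> k p = 0.
  by move=> /supp_eq0 p0; rewrite /k p0 mulr0 mul0r add0r expr0n.
have csh : compact (supp h).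
  apply: (subclosed_compact (@closed_closure _ _) cs).
  apply: suppS; first exact: closed_closure.
  by move=> p /supp_eq0 p0; rewrite /h p0 !mulr0.
(* [k] vanishes outside [Omega], so its integral over [Omega] is that over the plane. *)
have kI : I k = 0.
  rewrite -(integral_derive_compact_supp ch ck dh csh) [LHS]Rintegral_mkcond.
  apply: eq_Rintegral => p _; rewrite patchE; case: ifPn => //.
  by rewrite notin_setE => np; rewrite k0// => /sO.
have ik := testfun_integrable oO ck k0.
have /square_integrableE[_ id2] := testfun_square_integrable oO d.
have /square_integrableE[_ ip2] := testfun_square_integrable oO psi.
(* Adding 2 k, of integral 0, reduces the claim to a pointwise one: with x = [p.1], the difference
   of the two sides is (psi + 2 x d)^2 + 4 (M^2 - x^2) d^2. *)
have -> : 4 * M ^+ 2 * I (fun p => d p ^+ 2) =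
    I (fun p => 4 * M ^+ 2 * d p ^+ 2 + 2 * k p).
  rewrite Rintegral_affine//; last exact: (integrableZl mO 2 ik).
  by rewrite RintegralZl// kI mulr0 addr0.
apply: le_Rintegral => //.
  exact: (integrable_affine oO _ id2 (integrableZl mO 2 ik)).
move=> p /OM pM; rewrite /k.
have pM2 : p.1 ^+ 2 <= M ^+ 2.
  by rewrite -real_normK ?num_real// ler_sqr ?nnegrE// (le_trans _ pM).
have : 0 <= (M ^+ 2 - p.1 ^+ 2) * d p ^+ 2.
  by rewrite mulr_ge0 ?sqr_ge0// subr_ge0.
by have := sqr_ge0 (psi p + 2 * p.1 * d p); nra.
Qed.

End Poincare.

(** * The space H^1_0: linearity and uniqueness for the Laplace equation *)

Section H10.
Context {R : realType} (Omega : set (R * R)) (oO : open Omega).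
Local Notation mu2 := (@lebesgue_measure R \x @lebesgue_measure R)%E.
Local Notation RR := (measurableTypeR R * measurableTypeR R)%type.
Local Notation I f := (\int[mu2]_(p in Omega) f p).
Local Notation e1 := ((1, 0) : R * R).
Local Notation e2 := ((0, 1) : R * R).
Implicit Types (psi eta : testfun Omega) (S T : dist Omega).
Implicit Types (f g h : R * R -> R).

Let mO : measurable (Omega : set RR).
Proof. exact: open_measurable2. Qed.

Lemma integrable_sqrB f g : square_integrable Omega f ->
  square_integrable Omega g ->
  mu2.-integrable Omega (EFin \o (fun p => (f p - g p) ^+ 2)).
Proof.
move=> sf sg; have /square_integrableE[_] := square_integrableP oO (-1) sg sf.
congr (mu2.-integrable _ _); apply/funext => p /=; congr _%:E.
by rewrite -[(_ + _) p]/(-1 * g p + f p); ring.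
Qed.

(** Squeezed by the pointwise bound (a x + y)^2 <= 2 a^2 x^2 + 2 y^2. *)
Lemma L2_cvgP (a : R) (h1 h2 : nat -> R * R -> R) g1 g2 :
  square_integrable Omega g1 -> square_integrable Omega g2 ->
  (forall n, square_integrable Omega (h1 n)) ->
  (forall n, square_integrable Omega (h2 n)) ->
  L2_cvg Omega h1 g1 -> L2_cvg Omega h2 g2 ->
  L2_cvg Omega (fun n => a *: h1 n + h2 n) (a *: g1 + g2).
Proof.
move=> sg1 sg2 sh1 sh2 /(L2_cvgE oO sg1 sh1) c1 /(L2_cvgE oO sg2 sh2) c2.
have sg := square_integrableP oO a sg1 sg2.
have sh n := square_integrableP oO a (sh1 n) (sh2 n).
apply/(L2_cvgE oO sg sh).
have c : 2 * a ^+ 2 * I (fun p => (h1 n p - g1 p) ^+ 2) +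
    2 * I (fun p => (h2 n p - g2 p) ^+ 2) @[n --> \oo] --> (0 : R).
  rewrite -[X in _ --> X](addr0 0) -[X in _ --> X + _](mulr0 (2 * a ^+ 2)).
  rewrite -[X in _ --> _ + X](mulr0 2).
  by apply: cvgD; apply: cvgMr.
apply: (squeeze_cvgr _ (cvg_cst 0) c); apply: nearW => n.
rewrite Rintegral_sqr_ge0/= -[X in _ <= _ + X]RintegralZl//; last exact: integrable_sqrB.
rewrite -Rintegral_affine//; last 2 first.
- exact: integrable_sqrB.
- exact: (integrableZl mO 2 (integrable_sqrB (sh2 n) sg2)).
apply: le_Rintegral => //; first exact: integrable_sqrB.
  apply: integrable_affine => //; first exact: integrable_sqrB.
  exact: (integrableZl mO 2 (integrable_sqrB (sh2 n) sg2)).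
move=> p _; rewrite -[(a *: h1 n + h2 n) p]/(a * h1 n p + h2 n p).
rewrite -[(a *: g1 + g2) p]/(a * g1 p + g2 p).
have := sqr_ge0 (a * (h1 n p - g1 p) - (h2 n p - g2 p)); nra.
Qed.

(** Linear combinations of the approximating test functions approximate the combination. This lets
    injectivity on H^1_0 be checked on differences. *)
Lemma H10P (a : R) S T : H10 S -> H10 T -> H10 (a *: S + T).
Proof.
move=> [g [gx [gy [[sg sgx sgy] [Sg Sx Sy] [psi [cg cx cy]]]]]].
move=> [h [hx [hy [[sh shx shy] [Th Tx Ty] [eta [ch cx' cy']]]]]].
exists (a *: g + h), (a *: gx + hx), (a *: gy + hy).
have sP := square_integrableP oO; have sl := square_integrable_loc oO.
have st := testfun_square_integrable oO.
split; first by split; exact: sP.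
  have dxP : dx (a *: S + T) = a *: dx S + dx T by exact: linearP.
  have dyP : dy (a *: S + T) = a *: dy S + dy T by exact: linearP.
  by rewrite dxP dyP Sx Sy Tx Ty Sg Th !fun_distP//; exact: sl.
have dE v : (fun n => a *: (testfun_derive v (psi n) : R * R -> R) +
    testfun_derive v (eta n)) = (fun n => testfun_derive v (a *: psi n + eta n)).
  by apply/funext => n; rewrite testfun_derive_affine.
have cE v gv hv : square_integrable Omega gv -> square_integrable Omega hv ->
    L2_cvg Omega (fun n => testfun_derive v (psi n)) gv ->
    L2_cvg Omega (fun n => testfun_derive v (eta n)) hv ->
    L2_cvg Omega (fun n => testfun_derive v (a *: psi n + eta n)) (a *: gv + hv).
  by move=> sgv shv c c'; rewrite -dE; exact: L2_cvgP.
exists (fun n => a *: psi n + eta n); split.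
- exact: (L2_cvgP a sg sh _ _ cg ch).
- exact: (cE e1 gx hx).
- exact: (cE e2 gy hy).
Qed.

Lemma H10_regular T : H10 T -> regular (dx T) /\ regular (dy T).
Proof.
move=> [g [gx [gy [[_ sx sy] [_ Tx Ty] _]]]].
by split; [exists gx|exists gy] => //; exact: (square_integrable_loc oO).
Qed.

(** Pythagoras in L2 for the orthogonal fields (f, g) and (h, k), to be used for the gradients of a
    harmonic T and of a test function. Only the part in [h] is kept, as the Poincare inequality is
    taken in the x direction. *)
Lemma Rintegral_orthogonal_le f g h k :
  square_integrable Omega f -> square_integrable Omega g ->
  square_integrable Omega h -> square_integrable Omega k ->
  I (fun p => f p * h p) + I (fun p => g p * k p) = 0 ->
  I (fun p => h p ^+ 2) <=
    I (fun p => (h p - f p) ^+ 2) + I (fun p => (k p - g p) ^+ 2).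
Proof.
move=> sf sg sh sk orth.
have hf := integrable_affine oO 2 (integrable_mul oO sf sh)
  (integrable_sqrB sh sf).
have kg := integrable_affine oO 2 (integrable_mul oO sg sk)
  (integrable_sqrB sk sg).
have -> : I (fun p => (h p - f p) ^+ 2) + I (fun p => (k p - g p) ^+ 2) =
    I (fun p => 2 * (f p * h p) + (h p - f p) ^+ 2 +
      (2 * (g p * k p) + (k p - g p) ^+ 2)).
  rewrite (RintegralD mO hf kg) !Rintegral_affine//;
    [|exact: integrable_mul|exact: integrable_sqrB
     |exact: integrable_mul|exact: integrable_sqrB].
  by rewrite addrACA -mulrDr orth mulr0 add0r.
apply: le_Rintegral => //; first by case/square_integrableE: sh.
  exact: (integrableD mO hf kg).
move=> p _; have := sqr_ge0 (f p); have := sqr_ge0 (g p).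
by have := sqr_ge0 (k p); nra.
Qed.

Lemma H10_laplacian_inj T :
  bounded_set Omega -> H10 T -> laplacian T = 0 -> T = 0.
Proof.
move=> /bounded_set_prod[M _ OM].
move=> [g [gx [gy [[sg sx sy] [Tg Tx Ty] [psi [cg cx cy]]]]]] lapT.
pose d v n := testfun_derive v (psi n).
have st := testfun_square_integrable oO.
have {}cg := (L2_cvgE oO sg (fun n => st (psi n))).1 cg.
have {}cx := (L2_cvgE oO sx (fun n => st (d e1 n))).1 cx.
have {}cy := (L2_cvgE oO sy (fun n => st (d e2 n))).1 cy.
(* One derivative of the Laplacian is moved onto [psi n]: the gradients of [T] and [psi n] are
   orthogonal. *)
have orth n : I (fun p => gx p * d e1 n p) + I (fun p => gy p * d e2 n p) = 0.
  have : laplacian T (psi n) = 0 by rewrite lapT.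
  rewrite (_ : laplacian T (psi n) = - dx T (d e1 n) - dy T (d e2 n))//.
  rewrite Tx Ty !fun_distE; [|exact: square_integrable_loc..].
  by move=> /eqP; rewrite -opprD oppr_eq0 => /eqP.
have sq f : square_integrable Omega f ->
    mu2.-integrable Omega (EFin \o (fun p => f p ^+ 2)).
  by move=> /square_integrableE[].
have A_le n : I (fun p => d e1 n p ^+ 2) <=
    I (fun p => (d e1 n p - gx p) ^+ 2) + I (fun p => (d e2 n p - gy p) ^+ 2).
  exact: (Rintegral_orthogonal_le sx sy (st (d e1 n)) (st (d e2 n)) (orth n)).
have cA : I (fun p => d e1 n p ^+ 2) @[n --> \oo] --> (0 : R).
  have c0 : I (fun p => (d e1 n p - gx p) ^+ 2) +
      I (fun p => (d e2 n p - gy p) ^+ 2) @[n --> \oo] --> (0 : R).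
    by rewrite -[X in _ --> X](addr0 0); exact: cvgD.
  apply: (squeeze_cvgr _ (cvg_cst 0) c0); apply: nearW => n.
  by rewrite Rintegral_sqr_ge0 A_le.
have cP : I (fun p => psi n p ^+ 2) @[n --> \oo] --> (0 : R).
  have c0 : 4 * M ^+ 2 * I (fun p => d e1 n p ^+ 2) @[n --> \oo] --> (0 : R).
    by rewrite -[X in _ --> X](mulr0 (4 * M ^+ 2)); exact: cvgMr.
  apply: (squeeze_cvgr _ (cvg_cst 0) c0); apply: nearW => n.
  rewrite Rintegral_sqr_ge0 /=; apply: (poincare oO) => p.
  by move=> /OM[].
(* The bound g^2 <= 2 ((psi - g)^2 + psi^2) amounts to (2 psi - g)^2 >= 0. *)
have cG : I (fun p => g p ^+ 2) @[n --> \oo] --> (0 : R).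
  have c0 : 2 * (I (fun p => (psi n p - g p) ^+ 2) + I (fun p => psi n p ^+ 2))
      @[n --> \oo] --> (0 : R).
    rewrite -[X in _ --> X](mulr0 2); apply: cvgMr.
    by rewrite -[X in _ --> X](addr0 0); exact: cvgD.
  apply: (squeeze_cvgr _ (cvg_cst 0) c0); apply: nearW => n.
  have i1 := integrable_sqrB (st (psi n)) sg; have i2 := sq _ (st (psi n)).
  rewrite Rintegral_sqr_ge0/= -RintegralD// -RintegralZl//; last first.
    exact: (integrableD mO i1 i2).
  apply: le_Rintegral => //; first exact: sq.
    exact: (integrableZl mO 2 (integrableD mO i1 i2)).
  by move=> p _; have := sqr_ge0 (2 * psi n p - g p); nra.
have g0 : I (fun p => g p ^+ 2) = 0.
  exact: (cvg_unique (@Rhausdorff R) (cvg_cst _) cG).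
(* A density of zero L2 norm has zero pairing with every test function, so no almost everywhere
   argument is required. *)
apply: val_inj; apply/funext => eta; rewrite Tg.
rewrite [LHS]fun_distE; last exact: square_integrable_loc.
exact: Rintegral_mul_eq0 (st eta) g0.
Qed.

End H10.

(** * Injectivity of the Cauchy-Riemann operator matrix on H^1_0 *)

Section CauchyRiemann.
Context {R : realType} {Omega : set (R * R)}.
Implicit Types (U W : dist Omega * dist Omega).

Lemma cauchy_riemann_inj : open Omega -> bounded_set Omega ->
  set_inj (@H10 R Omega `*` @H10 R Omega) (@cauchy_riemann R Omega).
Proof.
move=> oO bO [u v] [u' v'] /set_mem[/= hu hv] /set_mem[/= hu' hv'].
move=> E; have ecurl : curl (u, v) = curl (u', v') := congr1 fst E.
have ediv : divergence (u, v) = divergence (u', v') := congr1 snd E.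
have eB (S T : dist Omega) : -1 *: T + S = S - T by rewrite scaleN1r addrC.
have hB (S T : dist Omega) : H10 S -> H10 T -> H10 (S - T).
  by move=> hS hT; rewrite -eB; exact: H10P.
(* The difference of two pairs with the same image has zero curl and zero divergence, so its
   components are harmonic. *)
have [||lu lv] := @laplacian_eq0 R Omega (u - u', v - v').
- rewrite /curl !linearB/= addrACA -opprD; apply/eqP; rewrite subr_eq0.
  exact/eqP.
- rewrite /divergence !linearB/= addrACA -opprD; apply/eqP; rewrite subr_eq0.
  exact/eqP.
have u0 := H10_laplacian_inj oO bO (hB _ _ hu hu') lu.
have v0 := H10_laplacian_inj oO bO (hB _ _ hv hv') lv.
by rewrite (subr0_eq u0) (subr0_eq v0).
Qed.

End CauchyRiemann.

(** * Diagonalization and the decoupled system *)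

Theorem mainTheorem2 (R : realType) (Omega : set (R * R))
    (openOmega : open Omega) (boundedOmega : bounded_set Omega)
    (a0 : R) (a0_gt0 : 0 < a0)
    (phi : R -> R) (smooth_phi : smooth phi)
    (phi_increasing : {homo phi : x y / x <= y})
    (f : R * R -> R) (measurable_f : measurable_fun Omega f)
    (phif_bounded : exists M : R, forall p, Omega p -> `|phi (f p)| <= M)
    (k_gt0 : forall p, Omega p -> 0 < 1 + a0 * phi (f p)) :
  let phif := fun p => phi (f p) in
  let k := fun p => 1 + a0 * phi (f p) in
  let A := flow_op a0 phif in
  let CR := @cauchy_riemann R Omega in
  let D := diagonal_op k in
  let dom := @H10 R Omega `*` @H10 R Omega in
  let CRinv := 'pinv_(fun=> 0) dom CR in
  [/\ forall U, regular (divergence U) -> CR (A U) = D (CR U),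
      set_inj dom CR,
      forall W, (CR @` dom) W -> D W = CR (A (CRinv W)) &
      forall (u0 v0 : dist Omega) (u v : R -> dist Omega),
        flow_system a0 phif u0 v0 u v ->
        let U := fun t => (u t, v t) in
        let xi := fun t => curl (U t) in
        let zeta := fun t => divergence (U t) in
        [/\ time_derivative2 U (A \o U),
            time_derivative2 (CR \o U) (D \o CR \o U),
            time_derivative xi (fun t => laplacian (xi t)) &
            time_derivative zeta (fun t => laplacian (mult k (zeta t)))]].
Proof.
move=> phif k A CR D dom CRinv; have [M phifM] := phif_bounded.
have mphif : measurable_fun Omega phif.
  apply: measurableT_comp measurable_f; apply: continuous_measurable_fun.
  exact: smooth_continuous.
have CRA U : regular (divergence U) -> CR (A U) = D (CR U).
  exact: (flow_op_diagonal a0 mphif phifM).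
(* First derivatives of elements of H^1_0 are L2 functions, so the divergence has a density. *)
have reg U : dom U -> regular (divergence U).
  move=> [/(H10_regular openOmega)[ru _] /(H10_regular openOmega)[_ rv]].
  by rewrite /divergence -[dx _]scale1r; exact: regularP.
have injCR : set_inj dom CR by exact: cauchy_riemann_inj.
split=> [//|//|W [U dU <-]|u0 v0 u v [tu tv _ hH] U xi zeta].
  (* By injectivity [CRinv] recovers [U] from [CR U], and D = R A R^-1 becomes the intertwining
     identity at [U]. *)
  rewrite /CRinv pinvKV//; last exact/mem_set.
  by rewrite CRA//; exact: reg.
have tU : time_derivative2 U (A \o U) by split; [exact: tu|exact: tv].
have E t : 0 < t -> CR (A (U t)) = D (CR (U t)).
  by move=> /hH[hu hv]; apply: CRA; apply: reg; split.
(* [CR] consists of derivatives in space, which commute with the weak time derivative. *)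
have tCR : time_derivative2 (CR \o U) (CR \o A \o U).
  split.
    apply: time_derivativeD; first exact: (time_derivative_derive _ tu).
    by apply: time_derivativeN; exact: (time_derivative_derive _ tv).
  by apply: time_derivativeD; [exact: (time_derivative_derive _ tu)
    |exact: (time_derivative_derive _ tv)].
have tCRD : time_derivative2 (CR \o U) (D \o CR \o U).
  case: tCR => t1 t2; split.
    by apply: time_derivative_eq t1 => // t t0; exact: (congr1 fst (E t t0)).
  by apply: time_derivative_eq t2 => // t t0; exact: (congr1 snd (E t t0)).
split=> [//|//||].
  (* The off-diagonal zeros of [D] leave a zero summand in each row. *)
  apply: time_derivative_eq tCRD.1 => // t _.
  exact: (addr0 (laplacian (xi t))).
apply: time_derivative_eq tCRD.2 => // t _.
exact: (add0r (laplacian (mult k (zeta t)))).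
Qed.
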